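(* Let $\mathbb F_2$ be the free group with free generators $a,b$. Let $\alpha,\beta:\mathbb Z\to\mathbb Z$ be bounded odd functions such that $\alpha(n)\neq0$ for all but finitely many $n\in\mathbb Z$, and let $f:\mathbb F_2\to\mathbb Z$ be given by $$f(a^{n_1}b^{m_1}\cdots a^{n_k}b^{m_k}):=\sum_{i=1}^k\bigl(\alpha(n_i)+\beta(m_i)\bigr),$$ where $n_i\neq0$ for $1<i\leq k$ and $m_i\neq0$ for $1\leq i<k$. Let $M$ be the two-sorted structure with sorts the groups $(\mathbb F_2,\cdot)$ and $(\mathbb Z,+)$ together with the function $f$ (or any expansion of this structure), let $M^*\succ M$ be a monster model with corresponding sorts $\mathbb F_2^*,\mathbb Z^*$ and function $f^*:\mathbb F_2^*\to\mathbb Z^*$, let $X\subseteq\mathbb F_2^*\times\mathbb Z^*$ be the graph of $f^*$ (which is a $\emptyset$-definable approximate subgroup), and let $H:=\langle X\rangle$ be the subgroup of $\mathbb F_2^*\times\mathbb Z^*$ generated by $X$. Then $H^{00}_\emptyset$ does not exist.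
   Context: A monster model is $\kappa$-saturated and strongly $\kappa$-homogeneous for a sufficiently large cardinal $\kappa$; bounded means of cardinality $<\kappa$. An approximate subgroup of a group is a symmetric subset $X$ such that $X^2=XX$ is contained in finitely many left translates of $X$. If $H$ contains a $\emptyset$-type-definable subgroup of bounded index in $H$, then there is a smallest such subgroup, denoted $H^{00}_\emptyset$; thus ''$H^{00}_\emptyset$ does not exist'' means that $H$ contains no $\emptyset$-type-definable subgroup of bounded index. *)

(* Defs.v *)
From HB Require Import structures.
From mathcomp Require Import all_boot all_order all_algebra.
From mathcomp Require Import classical_sets functions cardinality.

Set Implicit Arguments.
Unset Strict Implicit.
Unset Printing Implicit Defensive.

Import Order.TTheory GRing.Theory Num.Theory.
Local Open Scope classical_set_scope.
Local Open Scope card_scope.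

Inductive sort2 := SF | SZ.

(* Constants are function symbols of arity 0. *)
Record language := Language {
  fsym : Type;
  far : fsym -> nat;
  fdom : forall g : fsym, 'I_(far g) -> sort2;
  fcod : fsym -> sort2;
  rsym : Type;
  rar : rsym -> nat;
  rdom : forall r : rsym, 'I_(rar r) -> sort2 }.

Record interp (L : language) (car : sort2 -> Type) := Interp {
  fint : forall g : fsym L,
    (forall i : 'I_(far g), car (fdom i)) -> car (fcod g);
  rint : forall r : rsym L, (forall i : 'I_(rar r), car (rdom i)) -> Prop }.

Record structure (L : language) := Structure {
  car :> sort2 -> Type;
  itp : interp L car }.

(* Variables are named: each sort has its own copy of nat. *)
Inductive term (L : language) : sort2 -> Type :=
| Var (s : sort2) (n : nat) : term L s
| App (g : fsym L) (ts : forall i : 'I_(far g), term L (fdom i)) :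
    term L (fcod g).

Inductive formula (L : language) : Type :=
| Eq (s : sort2) (t u : term L s)
| Rel (r : rsym L) (ts : forall i : 'I_(rar r), term L (rdom i))
| Bot
| Imp (phi psi : formula L)
| All (s : sort2) (n : nat) (phi : formula L).

Fixpoint tfv (L : language) (s : sort2) (t : term L s) (s' : sort2) (n' : nat) :
    Prop :=
  match t with
  | Var s n => s' = s /\ n' = n
  | App g ts => exists i, tfv (ts i) s' n'
  end.

Fixpoint fv (L : language) (phi : formula L) (s' : sort2) (n' : nat) : Prop :=
  match phi with
  | Eq s t u => tfv t s' n' \/ tfv u s' n'
  | Rel r ts => exists i, tfv (ts i) s' n'
  | Bot => False
  | Imp phi psi => fv phi s' n' \/ fv psi s' n'
  | All s n phi => fv phi s' n' /\ ~ (s' = s /\ n' = n)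
  end.

Definition assignment (car : sort2 -> Type) := forall s : sort2, nat -> car s.

Definition upd (car : sort2 -> Type) (v : assignment car) (s : sort2) (n : nat) :
    car s -> assignment car :=
  match s return car s -> assignment car with
  | SF => fun x s' => match s' return nat -> car s' with
                      | SF => fun n' => if n' == n then x else v SF n'
                      | SZ => v SZ
                      end
  | SZ => fun x s' => match s' return nat -> car s' with
                      | SF => v SF
                      | SZ => fun n' => if n' == n then x else v SZ n'
                      end
  end.

Fixpoint teval (L : language) (N : structure L) (v : assignment N)
    (s : sort2) (t : term L s) : N s :=
  match t in term _ s return N s with
  | Var s n => v s n
  | App g ts => fint (itp N) (fun i => teval v (ts i))
  end.

Fixpoint sat (L : language) (N : structure L) (v : assignment N)
    (phi : formula L) : Prop :=
  match phi with
  | Eq s t u => teval v t = teval v u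
  | Rel r ts => rint (itp N) (fun i => teval v (ts i))
  | Bot => False
  | Imp phi psi => sat v phi -> sat v psi
  | All s n phi => forall x : N s, sat (upd v n x) phi
  end.

Definition elementary_embedding (L : language) (M N : structure L)
    (j : forall s, M s -> N s) : Prop :=
  forall (phi : formula L) (v : assignment M),
    sat v phi <-> sat (fun s n => j s (v s n)) phi.

Definition automorphism (L : language) (N : structure L)
    (sigma : forall s, N s -> N s) : Prop :=
  [/\ forall s, bijective (sigma s),
      forall (g : fsym L) (x : forall i : 'I_(far g), N (fdom i)),
        sigma _ (fint (itp N) x) = fint (itp N) (fun i => sigma _ (x i))
    & forall (r : rsym L) (x : forall i : 'I_(rar r), N (rdom i)),
        rint (itp N) x <-> rint (itp N) (fun i => sigma _ (x i))].

(* Cardinals are represented by types: A has cardinality < |K|. *)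
Definition smaller (T : Type) (A : set T) (K : Type) : Prop :=
  ~ ([set: K] #<= A).

(* A pair (phi, v) stands for the formula phi(x, c) in the single variable x,
   namely variable 0 of sort s, where v gives the values c of the other free
   variables of phi; these parameters are required to lie in A. *)
Definition over (L : language) (N : structure L) (A : forall s, set (N s))
    (s : sort2) (q : formula L * assignment N) : Prop :=
  forall s' n, fv q.1 s' n -> ~ (s' = s /\ n = 0) -> A s' (q.2 s' n).

Definition realizes (L : language) (N : structure L) (s : sort2) (x : N s)
    (p : set (formula L * assignment N)) : Prop :=
  forall q, p q -> sat (upd q.2 0 x) q.1.

Definition saturated (K : Type) (L : language) (N : structure L) : Prop :=
  forall A : forall s, set (N s), (forall s, smaller (A s) K) ->
  forall (s : sort2) (p : set (formula L * assignment N)),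
    (forall q, p q -> over A s q) ->
    (forall p0, finite_set p0 -> p0 `<=` p -> exists x : N s, realizes x p0) ->
    exists x : N s, realizes x p.

Definition partial_elementary (L : language) (N : structure L)
    (A : forall s, set (N s)) (h : forall s, N s -> N s) : Prop :=
  forall (phi : formula L) (v : assignment N),
    (forall s n, fv phi s n -> A s (v s n)) ->
    sat v phi <-> sat (fun s n => h s (v s n)) phi.

Definition strongly_homogeneous (K : Type) (L : language) (N : structure L) :
    Prop :=
  forall A : forall s, set (N s), (forall s, smaller (A s) K) ->
  forall h : forall s, N s -> N s, partial_elementary A h ->
  exists2 sigma, automorphism sigma & forall s x, A s x -> sigma s x = h s x.

(* The requirement that the cardinal |K| be sufficiently large is made explicit
   as |K| > |L| + aleph_0. *)
Definition monster (K : Type) (L : language) (N : structure L) : Prop :=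
  [/\ smaller [set: nat] K, smaller [set: fsym L] K, smaller [set: rsym L] K,
      saturated K N & strongly_homogeneous K N].

Inductive base_fsym := Fmul | Zadd | FtoZ.

Definition base_language : language :=
  {| fsym := base_fsym;
     far g := match g with Fmul => 2 | Zadd => 2 | FtoZ => 1 end;
     fdom g := match g with
               | Fmul => fun=> SF | Zadd => fun=> SZ | FtoZ => fun=> SF end;
     fcod g := match g with Fmul => SF | Zadd => SZ | FtoZ => SZ end;
     rsym := void;
     rar r := match r with end;
     rdom r := match r with end |}.

Definition carrier (F Z : Type) (s : sort2) : Type :=
  match s with SF => F | SZ => Z end.

Definition base_interp (F : groupType) (Z : zmodType) (f : F -> Z) :
    interp base_language (carrier F Z) :=
  {| fint g := match g return
         (forall i : 'I_(@far base_language g), carrier F Z (fdom i)) ->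
         carrier F Z (@fcod base_language g) with
       | Fmul => fun x : 'I_2 -> F => (x ord0 * x ord_max)%g
       | Zadd => fun x : 'I_2 -> Z => (x ord0 + x ord_max)%R
       | FtoZ => fun x : 'I_1 -> F => f (x ord0)
       end;
     rint r := match r with end |}.

(* The base language together with additional symbols E on the same sorts. *)
Definition sum_language (L E : language) : language :=
  {| fsym := fsym L + fsym E;
     far g := match g with inl g => far g | inr g => far g end;
     fdom g := match g with inl g => @fdom L g | inr g => @fdom E g end;
     fcod g := match g with inl g => fcod g | inr g => fcod g end;
     rsym := rsym L + rsym E;
     rar r := match r with inl r => rar r | inr r => rar r end;
     rdom r := match r with inl r => @rdom L r | inr r => @rdom E r end |}.

Definition sum_interp (L E : language) (car : sort2 -> Type)
    (I : interp L car) (J : interp E car) : interp (sum_language L E) car :=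
  {| fint g := match g return
         (forall i : 'I_(@far (sum_language L E) g), car (fdom i)) ->
         car (@fcod (sum_language L E) g) with
       | inl g => @fint _ _ I g
       | inr g => @fint _ _ J g
       end;
     rint r := match r return
         (forall i : 'I_(@rar (sum_language L E) r), car (rdom i)) -> Prop with
       | inl r => @rint _ _ I r
       | inr r => @rint _ _ J r
       end |}.

Definition expansion (F : groupType) (Z : zmodType) (f : F -> Z)
    (E : language) (J : interp E (carrier F Z)) :
    structure (sum_language base_language E) :=
  {| car := carrier F Z; itp := sum_interp (base_interp f) J |}.

(* phi(x, y) has no free variables besides x = variable 0 of sort SF and
   y = variable 0 of sort SZ, so only these values of [pair_assignment] matter. *)
Definition formula_xy (L : language) (phi : formula L) : Prop :=
  forall s n, fv phi s n -> n = 0.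

Definition pair_assignment (car : sort2 -> Type) (x : car SF * car SZ) :
    assignment car :=
  fun s _ => match s return car s with SF => x.1 | SZ => x.2 end.

Definition definable0 (L : language) (N : structure L)
    (S : set (N SF * N SZ)) : Prop :=
  exists2 phi : formula L, formula_xy phi &
    S = [set x | sat (pair_assignment x) phi].

Definition type_definable0 (L : language) (N : structure L)
    (S : set (N SF * N SZ)) : Prop :=
  exists2 p : set (formula L), (forall phi, p phi -> formula_xy phi) &
    S = [set x | forall phi, p phi -> sat (pair_assignment x) phi].

Definition is_subgroup (G : groupType) (S : set G) : Prop :=
  [/\ S 1%g, forall x y, S x -> S y -> S (x * y)%g
    & forall x, S x -> S (x^-1)%g].

Definition generated (G : groupType) (X : set G) : set G :=
  smallest (@is_subgroup G) X.

Definition approximate_subgroup (G : groupType) (X : set G) : Prop :=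
  [set (x^-1)%g | x in X] = X /\
  exists2 C : set G, finite_set C &
    [set (x * y)%g | x in X & y in X] `<=` [set (c * x)%g | c in C & x in X].

Definition bounded_index (K : Type) (G : groupType) (H S : set G) : Prop :=
  smaller [set [set (h * x)%g | x in S] | h in H] K.

Definition free_generators (F : groupType) (a b : F) : Prop :=
  forall (G : groupType) (x y : G),
  exists! h : F -> G,
    [/\ {morph h : u v / (u * v)%g >-> (u * v)%g}, h a = x & h b = y].

Definition expgz (G : groupType) (x : G) (n : int) : G :=
  match n with Posz k => (x ^+ k)%g | Negz k => (x ^- k.+1)%g end.

(* The product of the multiplicative group F and the additive group Z. *)
Definition product_group (F : groupType) (Z : zmodType) : groupType :=
  (F * Algebra.to_multiplicative Z)%type.

Definition graph (F : groupType) (Z : zmodType) (f : F -> Z) :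
    set (product_group F Z) :=
  [set x | x.2 = f x.1].

Definition bounded_odd (alpha : int -> int) : Prop :=
  (exists B : int, forall n, `|alpha n| <= B)%R /\
  (forall n, alpha (- n) = - alpha n)%R.

(* Indices run from 0 to k - 1 instead of from 1 to k; the word with k = 0 is
   the neutral element, which is also the word with k = 1, n 0 = m 0 = 0. *)
Definition on_words (F : groupType) (a b : F) (alpha beta : int -> int)
    (f : F -> int) : Prop :=
  forall (k : nat) (n m : nat -> int),
    (forall i, 0 < i < k -> n i != 0%R)%N ->
    (forall i, i.+1 < k -> m i != 0%R)%N ->
    f (\prod_(i < k) (expgz a (n i) * expgz b (m i)))%g =
      (\sum_(i < k) (alpha (n i) + beta (m i)))%R.

(* Main.v *)
(**
  A type-definable subgroup S of H lies, by compactness, in a set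
  {(x, f x + e) : |e| <= n} with n standard.  If (c, y) is in S and the values
  f (c^k) are within a standard distance of k t for all k, then so are the k y,
  hence y = t.  The centralizer of a in the nonstandard free group is large
  and f c is nonzero for most of its elements, so bounded index produces (c, y)
  in S with c in the centralizer of a and f c <> 0; likewise (d, z) in S with
  d <> 1 in the centralizer of b.  As f is bounded on both centralizers,
  y = z = 0.  But f ((c d)^k) = k (f c + f d) and f ((c d^-1)^k) = k (f c - f d),
  so f c + f d = 0 = f c - f d and 2 f c = 0, a contradiction.

  In the standard model the centralizer of a consists of the powers of a,
  which follows from ping-pong for the Sanov action on Z^2.
*)
From HB Require Import structures.
Require Import Defs.
From mathcomp Require Import all_boot all_order all_algebra.
From mathcomp Require Import boolp classical_sets functions cardinality.
From mathcomp Require Import zify ring.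

Set Implicit Arguments.
Unset Strict Implicit.
Unset Printing Implicit Defensive.

Import Order.TTheory GRing.Theory Num.Theory.
Local Open Scope classical_set_scope.

(** * Groups from freeness: subgroups, bijections, integer powers *)

Section Subgroup.
Local Open Scope group_scope.
Variables (G : groupType) (P : set G).

(** Freeness quantifies over group types, so a subgroup has to become one; the proof that [P] is a
    subgroup is a parameter on which the group instance is built. *)
Definition subgroup_of of is_subgroup P := {x : G | `[< P x >]}.

Variable hP : is_subgroup P.
Local Notation T := (subgroup_of hP).

HB.instance Definition _ := SubType.copy T {x : G | `[< P x >]}.
HB.instance Definition _ := Choice.copy T {x : G | `[< P x >]}.

Definition subgroup_one : T.
Proof. by exists 1; apply/asboolP; case: hP. Defined.

Definition subgroup_mul (x y : T) : T.
Proof.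
exists (val x * val y); apply/asboolP; case: hP => _ hM _.
by apply: hM; apply/asboolP; [case: x | case: y].
Defined.

Definition subgroup_inv (x : T) : T.
Proof.
exists (val x)^-1; apply/asboolP; case: hP => _ _ hV.
by apply: hV; apply/asboolP; case: x.
Defined.

Fact subgroup_mulA : associative subgroup_mul.
Proof. by move=> x y z; apply: val_inj => /=; rewrite mulgA. Qed.
Fact subgroup_mul1 : left_id subgroup_one subgroup_mul.
Proof. by move=> x; apply: val_inj => /=; rewrite mul1g. Qed.
Fact subgroup_mulr1 : right_id subgroup_one subgroup_mul.
Proof. by move=> x; apply: val_inj => /=; rewrite mulg1. Qed.
Fact subgroup_mulV : left_inverse subgroup_one subgroup_inv subgroup_mul.
Proof. by move=> x; apply: val_inj => /=; rewrite mulVg. Qed.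
Fact subgroup_mulrV : right_inverse subgroup_one subgroup_inv subgroup_mul.
Proof. by move=> x; apply: val_inj => /=; rewrite mulgV. Qed.

HB.instance Definition _ := isGroup.Build T subgroup_mulA subgroup_mul1
  subgroup_mulr1 subgroup_mulV subgroup_mulrV.

End Subgroup.

(* The inclusion of a subgroup containing a and b has a section by freeness, and
   the composite fixes a and b, hence is the identity. *)
Lemma free_generated (F : groupType) (a b : F) (P : set F) :
  free_generators a b -> is_subgroup P -> P a -> P b -> forall x, P x.
Proof.
move=> hF hP Pa Pb x.
have qa : `[< P a >] by apply/asboolP.
have qb : `[< P b >] by apply/asboolP.
have [h [[hM ha hb] _]] :=
  hF (subgroup_of hP : groupType) (exist _ a qa) (exist _ b qb).
have [g [_ gU]] := hF F a b.
have e1 : g = id by apply: gU.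
have e2 : g = (fun x => sval (h x)).
  by apply: gU; split; rewrite ?ha ?hb // => u v; rewrite hM.
have -> : x = sval (h x) by rewrite -[LHS]/(id x) -e1 e2.
by apply/asboolP; apply: (svalP (h x)).
Qed.

Section Bijections.
Variable T : Type.

Record bijection := Bijection {
  bfun :> T -> T;
  binv : T -> T;
  bfunK : cancel bfun binv;
  binvK : cancel binv bfun }.

Lemma bijectionP (f g : bijection) : bfun f =1 bfun g -> f = g.
Proof.
case: f => f f' fK f'K; case: g => g g' gK g'K /= /funext efg.
subst g; have e : f' = g' by apply: funext => x; rewrite -[x in LHS]g'K fK.
by subst g'; rewrite (Prop_irrelevance fK gK) (Prop_irrelevance f'K g'K).
Qed.

HB.instance Definition _ := gen_eqMixin bijection.
HB.instance Definition _ := gen_choiceMixin bijection.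

Definition bijection_one := @Bijection id id (fun=> erefl) (fun=> erefl).
(** The underlying functions are read off from the cancellation proofs: this is composition, with
    the right factor acting first. *)
Definition bijection_mul (f g : bijection) :=
  Bijection (can_comp (bfunK f) (bfunK g)) (can_comp (binvK g) (binvK f)).
Definition bijection_inv (f : bijection) := Bijection (binvK f) (bfunK f).

Fact bijection_mulA : associative bijection_mul.
Proof. by move=> f g h; apply: bijectionP. Qed.
Fact bijection_mul1 : left_id bijection_one bijection_mul.
Proof. by move=> f; apply: bijectionP. Qed.
Fact bijection_mulr1 : right_id bijection_one bijection_mul.
Proof. by move=> f; apply: bijectionP. Qed.
Fact bijection_mulV : left_inverse bijection_one bijection_inv bijection_mul.
Proof. by move=> f; apply: bijectionP => x /=; rewrite bfunK. Qed.
Fact bijection_mulrV : right_inverse bijection_one bijection_inv bijection_mul.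
Proof. by move=> f; apply: bijectionP => x /=; rewrite binvK. Qed.

HB.instance Definition _ := isGroup.Build bijection bijection_mulA bijection_mul1
  bijection_mulr1 bijection_mulV bijection_mulrV.

End Bijections.

Section IntegerPowers.
Local Open Scope group_scope.
Variable G : groupType.
Implicit Types (x : G) (m n : int).

Lemma expgzS x n : expgz x (n + 1)%R = expgz x n * x.
Proof.
case: n => n.
  have -> : (Posz n + 1)%R = Posz n.+1 by lia.
  by rewrite /= expgSr.
case: n => [|n]; first by rewrite /= mulVg.
have -> : (Negz n.+1 + 1)%R = Negz n by lia.
by rewrite /= (expgS x n.+1) invgM mulgVK.
Qed.

Lemma expgzB1 x n : expgz x (n - 1)%R = expgz x n * x^-1.
Proof. by rewrite -[in RHS](subrK 1%R n) expgzS mulgK. Qed.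

Lemma expgzD x m n : expgz x (m + n)%R = expgz x m * expgz x n.
Proof.
elim/int_rect: n => [|n IH|n IH]; first by rewrite addr0 mulg1.
- by rewrite intS [(1 + _)%R]addrC addrA !expgzS IH mulgA.
by rewrite intS opprD [(-1 + _)%R]addrC addrA !expgzB1 IH mulgA.
Qed.

Lemma expgzN x n : expgz x (- n)%R = (expgz x n)^-1.
Proof. by apply: (mulgI (expgz x n)); rewrite -expgzD subrr mulgV. Qed.

Lemma expgzM x m (k : nat) : expgz x m ^+ k = expgz x (m *+ k)%R.
Proof. by elim: k => [//|k IH]; rewrite expgS IH mulrS expgzD. Qed.

End IntegerPowers.

Lemma expgz_morph (G H : groupType) (h : G -> H) (x : G) (n : int) :
  {morph h : u v / (u * v)%g} -> h (expgz x n) = expgz (h x) n.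
Proof.
move=> hM.
have h1 : h 1%g = 1%g by apply: (mulgI (h 1%g)); rewrite -hM !mulg1.
elim/int_rect: n => [|n IH|n IH]; first exact: h1.
- by rewrite intS [(1 + _)%R]addrC !expgzS hM IH.
have hV u : (h u^-1 = (h u)^-1)%g by apply: (mulgI (h u)); rewrite -hM !mulgV.
by rewrite intS opprD [(-1 + _)%R]addrC !expgzB1 hM IH hV.
Qed.

(** * Words and the Sanov action *)

(* A syllable (true, n) stands for a^n and (false, n) for b^n. *)
Fixpoint reduced (l : seq (bool * int)) : bool :=
  if l is s :: l' then
    [&& s.2 != 0%R, (if l' is t :: _ then s.1 != t.1 else true) & reduced l']
  else true.

Lemma reduced_behead s l : reduced (s :: l) -> reduced l.
Proof. by case/and3P. Qed.

(** With [catrev] the junction lies between the two heads, so the induction moves one syllable at a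
    time across it. *)
Lemma reduced_catrev l1 l2 : reduced l1 -> reduced l2 ->
  (if (l1, l2) is (s :: _, t :: _) then s.1 != t.1 else true) ->
  reduced (catrev l1 l2).
Proof.
elim: l1 l2 => [//|s l1 IH] l2 /= /and3P[s0 sl r1] r2 c; apply: IH => //=.
  by rewrite s0 r2 !andbT.
by case: l1 sl {r1} => // t l1; rewrite eq_sym.
Qed.

Lemma reduced_rev l : reduced l -> reduced (rev l).
Proof. by move=> r; apply: reduced_catrev => //; case: l {r}. Qed.

Definition neg_syllable (s : bool * int) : bool * int := (s.1, - s.2)%R.

Lemma reduced_neg l : reduced l -> reduced (map neg_syllable l).
Proof.
elim: l => //= s l IH /and3P[s0 sl /IH ->].
by rewrite oppr_eq0 s0 andbT; case: l sl {IH}.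
Qed.

Section WordValue.
Local Open Scope group_scope.
Variables (G : groupType) (a b : G).

Definition letter (s : bool * int) : G := expgz (if s.1 then a else b) s.2.

Definition word_value l : G := \prod_(s <- l) letter s.

Lemma word_value_cons s l : word_value (s :: l) = letter s * word_value l.
Proof. exact: big_cons. Qed.

Lemma word_value_rev_cons s l :
  word_value (rev (s :: l)) = word_value (rev l) * letter s.
Proof. by rewrite /word_value rev_cons -cats1 big_cat big_seq1. Qed.

Lemma word_value_catrev l1 l2 :
  word_value (catrev l1 l2) = word_value (rev l1) * word_value l2.
Proof. by rewrite catrevE /word_value big_cat. Qed.

Lemma word_value_neg l :
  word_value (rev (map neg_syllable l)) = (word_value l)^-1.
Proof.
elim: l => [|s l IH]; first by rewrite /word_value /= !big_nil invg1.
rewrite [map _ _]/= word_value_rev_cons IH word_value_cons invgM.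
by rewrite /letter /= expgzN.
Qed.

Definition is_word (x : G) := exists2 l, reduced l & x = word_value l.

(** The syllable vanishes, is prepended, cancels the head or merges with it. *)
Lemma is_word_letter s x : is_word x -> is_word (letter s * x).
Proof.
case=> l rl ->; have [s0|s0] := eqVneq s.2 0%R.
  by exists l => //; rewrite /letter s0 mul1g.
case: l rl => [|t l] rl.
  by exists [:: s]; rewrite /= ?s0 // word_value_cons.
have [st|st] := eqVneq s.1 t.1; last first.
  by exists (s :: t :: l); [rewrite /= s0 st | rewrite -word_value_cons].
have [z|z] := eqVneq (s.2 + t.2)%R 0%R.
  exists l; first exact: reduced_behead rl.
  by rewrite word_value_cons mulgA /letter st -expgzD z mul1g.
exists ((t.1, (s.2 + t.2)%R) :: l); first by move: rl; rewrite /= z => /andP[].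
by rewrite !word_value_cons mulgA /letter st -expgzD.
Qed.

Hypothesis ab_free : free_generators a b.

(** Those [z] for which left multiplication by [z] and by [z^-1] both preserve values of reduced
    words form a subgroup containing [a] and [b]. *)
Lemma free_is_word x : is_word x.
Proof.
suff H : forall y, is_word y -> is_word (x * y).
  by rewrite -[x]mulg1; apply: H; exists [::] => //; rewrite /word_value big_nil.
pose P (z : G) := (forall y, is_word y -> is_word (z * y)) /\
                  (forall y, is_word y -> is_word (z^-1 * y)).
suff: P x by case.
apply: (free_generated ab_free).
- split=> [|u v [u1 u2] [v1 v2]|u [u1 u2]]; split=> y wy.
  + by rewrite mul1g.
  + by rewrite invg1 mul1g.
  + by rewrite -mulgA; apply/u1/v1.
  + by rewrite invgM -mulgA; apply/v2/u2.
  + exact: u2.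
  + by rewrite invgK; apply: u1.
- by split=> y wy; [apply: (@is_word_letter (true, 1%R))
                   | apply: (@is_word_letter (true, (-1)%R))].
- by split=> y wy; [apply: (@is_word_letter (false, 1%R))
                   | apply: (@is_word_letter (false, (-1)%R))].
Qed.

End WordValue.

(** * Ping-pong for the Sanov matrices on the integer plane *)

Section Sanov.
Local Open Scope ring_scope.

(** [shear1] and [shear2] are the matrices with rows (1, 2), (0, 1) and (1, 0), (2, 1), acting on
    column vectors. *)
Definition shear1 : bijection (int * int).
Proof.
by exists (fun p => (p.1 + 2 * p.2, p.2)) (fun p => (p.1 - 2 * p.2, p.2));
  case=> x y /=; rewrite ?addrK ?subrK.
Defined.

Definition shear2 : bijection (int * int).
Proof.
by exists (fun p => (p.1, p.2 + 2 * p.1)) (fun p => (p.1, p.2 - 2 * p.1));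
  case=> x y /=; rewrite ?addrK ?subrK.
Defined.

Lemma expgz_shear1 n p : expgz shear1 n p = (p.1 + 2 * n * p.2, p.2).
Proof.
elim/int_rect: n p => [|n IH|n IH] [x y]; first by rewrite mulr0 mul0r addr0.
- rewrite intS [1 + _]addrC expgzS /= [LHS]IH /=; congr pair; ring.
- rewrite intS opprD [-1 + _]addrC expgzB1 /= [LHS]IH /=; congr pair; ring.
Qed.

Lemma expgz_shear2 n p : expgz shear2 n p = (p.1, p.2 + 2 * n * p.1).
Proof.
elim/int_rect: n p => [|n IH|n IH] [x y]; first by rewrite mulr0 mul0r addr0.
- rewrite intS [1 + _]addrC expgzS /= [LHS]IH /=; congr pair; ring.
- rewrite intS opprD [-1 + _]addrC expgzB1 /= [LHS]IH /=; congr pair; ring.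
Qed.

(** The new coordinate has absolute value at least 2|y| - |x|, which exceeds |y|. *)
Lemma sanov_ping_pong (x y n : int) : n != 0 -> `|x| < `|y| -> `|y| < `|x + 2 * n * y|.
Proof.
move=> n0 xy.
have h1 : `|y| <= `|n * y| by rewrite normrM ler_peMl //; lia.
lia.
Qed.

(** Powers of the first shear fix (1, 0). Once a power of the second one has moved the vector off
    the axis, each further syllable makes the coordinate it changes the dominant one, so the vector
    never returns. *)
Lemma sanov_orbit l : reduced l ->
  let p := word_value shear1 shear2 l (1, 0) in
  (p.2 = 0 /\ (l = [::] \/ exists n, l = [:: (true, n)])) \/
  (p.2 != 0 /\
   if l is s :: _ then if s.1 then `|p.2| < `|p.1| else `|p.1| < `|p.2|
   else False).
Proof.
elim: l => [_|s l IH rl] p.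
  by left; rewrite /p /word_value big_nil; split=> //; left.
have {IH} := IH (reduced_behead rl); rewrite {}/p word_value_cons /=.
set q := bfun (word_value _ _ l) _.
have hq : l = [::] -> q = (1, 0) by move=> l0; rewrite /q l0 /word_value big_nil.
have hq1 n : l = [:: (true, n)] -> q = (1, 0).
  move=> l0; rewrite /q l0 word_value_cons /word_value big_nil mulg1.
  by rewrite /letter /= expgz_shear1 /= mulr0 addr0.
(* Three cases: the tail is empty, is a single power of the first shear, or has already left the
   axis. In the first two the vector is still (1, 0). *)
move: rl => /=/and3P[s0 sl rl] [[q0 [l0|[n l1]]]|[q0 hl]].
- rewrite hq // /letter; case: ifP => s1.
    rewrite expgz_shear1 /=; left; split=> //; right; exists s.2.
    by rewrite l0 -s1 -surjective_pairing.
  by rewrite expgz_shear2 /=; right; split; lia.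
- rewrite (hq1 n) // /letter; move: sl; rewrite l1 /=.
  by case: (s.1) => // _; rewrite expgz_shear2 /=; right; split; lia.
- right; move: hl; move: (q) => r; clear q hq hq1 q0.
  case: l sl {rl} => // t l; rewrite /letter.
  case: (s.1); case: (t.1) => //= _ h.
  + rewrite expgz_shear1 /=; split; last exact: sanov_ping_pong.
    by apply/eqP => z; move: h; rewrite z normr0 normr_lt0.
  + rewrite expgz_shear2 /=; have := sanov_ping_pong s0 h.
    by move=> k; split => //; apply/eqP => z; move: k; rewrite z normr0 normr_lt0.
Qed.

End Sanov.

Lemma free_generatorsC (F : groupType) (a b : F) :
  free_generators a b -> free_generators b a.
Proof.
move=> hF G x y; have [h [[hM ha hb] hU]] := hF G y x.
by exists h; split=> // g [gM gb ga]; apply: hU.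
Qed.

Lemma free_sanov (F : groupType) (a b : F) : free_generators a b ->
  exists2 h : F -> bijection (int * int),
    {morph h : u v / (u * v)%g} & h a = shear1 /\ h b = shear2.
Proof.
by case/(_ _ shear1 shear2) => h [[hM ha hb] _]; exists h.
Qed.

(** The n-th power of [a] sends (0, 1) to (2n, 1). *)
Lemma free_expgz_inj (F : groupType) (a b : F) : free_generators a b ->
  injective (expgz a).
Proof.
case/free_sanov => h hM [ha _] m n /(congr1 (fun x => h x (0, 1)%R)).
rewrite !(expgz_morph _ _ hM) ha !expgz_shear1 /= => -[]; lia.
Qed.

(* An element commuting with [a] maps the vector (1, 0), which [a] fixes, to a
   vector fixed by [a]; by ping-pong only powers of [a] do so. *)
Lemma free_centralizer (F : groupType) (a b : F) (x : F) :
  free_generators a b -> (x * a = a * x)%g -> exists n, x = expgz a n.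
Proof.
move=> hF; have [l rl ->] := free_is_word hF x => hx.
have [h hM [ha hb]] := free_sanov hF.
have hw : h (word_value a b l) = word_value shear1 shear2 l.
  elim: l {rl hx} => [|s l IH].
    by rewrite /word_value !big_nil; apply: (mulgI (h 1%g)); rewrite -hM !mulg1.
  rewrite !word_value_cons hM IH /letter (expgz_morph _ _ hM).
  by case: (s.1); rewrite ?ha ?hb.
have := congr1 (fun x => h x (1, 0)%R) hx.
rewrite !hM ha hw.
have := sanov_orbit rl => /=.
set p := bfun (word_value _ _ _) _ => hp e.
have {}e : shear1 p = p by exact: esym e.
(* [shear1] adds 2 * p.2 to the first coordinate, so it fixes only vectors on the axis. *)
have p0 : p.2 = 0%R by move: e; rewrite [p in _ = p]surjective_pairing => -[]; lia.
case: hp => [[_ [->|[n ->]]]|[]].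
- by exists 0%R; rewrite /word_value big_nil.
- by exists n; rewrite /word_value big_seq1.
- by rewrite p0.
Qed.

(** * The quasimorphism on the free group *)

Lemma expgz_seq_bound (F : groupType) (u : F) (ys : seq F) :
  (forall y, y \in ys -> exists m, y = expgz u m) ->
  exists C : int, forall y, y \in ys -> exists2 m, y = expgz u m & (`|m| <= C)%R.
Proof.
elim: ys => [|y ys IH] h; first by exists 0%R.
have [|C hC] := IH; first by move=> z zs; apply: h; rewrite inE zs orbT.
have [m ->] := h y (mem_head _ _).
exists (`|m| + `|C|)%R => z; rewrite inE => /orP[/eqP->|/hC [k -> ?]].
  by exists m => //; lia.
by exists k => //; lia.
Qed.

Lemma expgz_comm (F : groupType) (u : F) (m : int) : (expgz u m * u = u * expgz u m)%g.
Proof. by rewrite -[u in LHS]/(expgz u 1%R) -expgzS addrC expgzD. Qed.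

(** The given elements are powers of [a] with exponents bounded by some [D]; a power with exponent
    beyond [D] differs from all of them. *)
Lemma free_separated (F : groupType) (a b : F) (ys : seq F) :
  free_generators a b ->
  (forall y, y \in ys -> (y * a = a * y)%g) ->
  exists2 x, (x * a = a * x)%g & forall y, y \in ys -> (y^-1 * x)%g <> 1%g.
Proof.
move=> hF hys.
have [|D hD] := @expgz_seq_bound F a ys.
  by move=> y /hys /(free_centralizer hF).
exists (expgz a (`|D| + 1)%R); first exact: expgz_comm.
move=> y /hD[m -> mD]; rewrite -expgzN -expgzD.
by rewrite -[1%g]/(expgz a 0%R) => /(free_expgz_inj hF); lia.
Qed.

Section OnWords.
Local Open Scope ring_scope.
Variables (F : groupType) (a b : F) (alpha beta : int -> int) (f : F -> int).
Hypothesis hf : on_words a b alpha beta f.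

Definition weight (s : bool * int) : int := if s.1 then alpha s.2 else beta s.2.

Definition word_weight l : int := \sum_(s <- l) weight s.

(** As in [on_words], a zero exponent of [b] is tolerated in the last pair only. *)
Fixpoint proper_b_exponents (s : seq (int * int)) : bool :=
  if s is p :: s' then (nilp s' || (p.2 != 0)) && proper_b_exponents s' else true.

Definition pairs_value (s : seq (int * int)) : F :=
  (\prod_(p <- s) (expgz a p.1 * expgz b p.2))%g.

Definition pairs_weight (s : seq (int * int)) : int :=
  \sum_(p <- s) (alpha p.1 + beta p.2).

Lemma on_pairs s :
  all (fun p => p.1 != 0) (behead s) -> proper_b_exponents s ->
  f (pairs_value s) = pairs_weight s.
Proof.
move=> h1 h2; rewrite /pairs_value /pairs_weight !(big_nth (0, 0)) !big_mkord.
apply: (hf (n := fun i => (nth (0, 0) s i).1) (m := fun i => (nth (0, 0) s i).2)).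
  case: s h1 {h2} => [|p s] /= h1 [|i] // hi.
  by apply: (allP h1); apply: mem_nth.
elim: s h2 {h1} => [//|p s IH] /= /andP[p0 /IH h] [|i] hi /=; last exact: h.
by move: p0; case: s hi {IH h}.
Qed.

Hypotheses (alpha_odd : forall n, alpha (- n) = - alpha n)
           (beta_odd : forall n, beta (- n) = - beta n).

Let alpha0 : alpha 0 = 0.
Proof. by have := alpha_odd 0; rewrite oppr0; move: (alpha 0) => x; lia. Qed.

Let beta0 : beta 0 = 0.
Proof. by have := beta_odd 0; rewrite oppr0; move: (beta 0) => x; lia. Qed.

Lemma weight_opp s : weight (neg_syllable s) = - weight s.
Proof. by rewrite /weight /=; case: ifP => _. Qed.

(** Syllables are grouped into pairs for [on_words]. A leading power of [b] is paired with the
    exponent 0 of [a], which costs nothing as [alpha] vanishes at 0; the shape of the head is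
    recorded so that a preceding power of [a] can take that slot. *)
Lemma reduced_pairs l : reduced l -> exists s,
  [/\ proper_b_exponents s,
      match l with
      | [::] => s = [::]
      | (true, _) :: _ => all (fun p => p.1 != 0) s
      | (false, _) :: _ =>
          exists m s', s = (0, m) :: s' /\ all (fun p => p.1 != 0) s'
      end,
      pairs_value s = word_value a b l & pairs_weight s = word_weight l].
Proof.
rewrite /pairs_value /pairs_weight /word_value /word_weight.
elim: l => [_|[c n] l IH rl]; first by exists [::]; rewrite !big_nil.
have {IH} [s [bs hs vs ws]] := IH (reduced_behead rl).
move: rl => /=/and3P[n0 cl rl]; rewrite !big_cons {1}/weight {1}/letter /=.
case: c cl => cl; last first.
  exists ((0, n) :: s); rewrite !big_cons /= alpha0 mul1g add0r vs ws n0 orbT.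
  split=> //; exists n, s; split=> //.
  by case: l cl hs {rl vs ws} => [_ ->|[[] k] l].
case: l cl hs rl vs ws => [|[[] k] l] //= _ hs rl.
  rewrite hs !big_nil => _ _; exists [:: (n, 0)].
  by rewrite !big_seq1 /= beta0 n0 mulg1.
(* The next syllable is a power of [b], stored with exponent 0 for [a]; [n] replaces this 0. *)
have [m [s' [es hs']]] := hs; move: bs; rewrite es !big_cons /= => bs vs ws.
exists ((n, m) :: s'); rewrite !big_cons /= n0 bs hs'; split=> //.
  by rewrite -vs mul1g mulgA.
by rewrite -ws alpha0 add0r addrA.
Qed.

Lemma on_reduced l : reduced l -> f (word_value a b l) = word_weight l.
Proof.
move=> /reduced_pairs[s [bs hs <- <-]]; apply: on_pairs => //.
case: l hs => [->|[[] k] l] //; first by case: s {bs} => //= p s /andP[].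
by case=> m [s' [-> ]].
Qed.

Variable B : int.
Hypotheses (alpha_le : forall n, `|alpha n| <= B)
           (beta_le : forall n, `|beta n| <= B).

Let weight_le s : `|weight s| <= B.
Proof. by rewrite /weight /=; case: ifP => _. Qed.

Lemma word_weight_cons s l : word_weight (s :: l) = weight s + word_weight l.
Proof. exact: big_cons. Qed.

Lemma word_weight_rev l : word_weight (rev l) = word_weight l.
Proof. by rewrite /word_weight; apply: perm_big; rewrite perm_rev. Qed.

Lemma on_reduced_catrev l1 l2 : reduced (catrev l1 l2) ->
  f (word_value a b (rev l1) * word_value a b l2)%g
  = word_weight l1 + word_weight l2.
Proof.
move=> r; rewrite -word_value_catrev on_reduced //.
by rewrite -(word_weight_rev l1) catrevE /word_weight big_cat.
Qed.

(* If the last syllable of the first factor and the first of the second one are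
   powers of the same generator, either they cancel, contributing 0 to the
   defect, or they merge and the product is reduced. *)
Lemma on_words_defect_rev l1 l2 : reduced l1 -> reduced l2 ->
  `|f (word_value a b (rev l1) * word_value a b l2)%g
    - word_weight l1 - word_weight l2| <= 3 * B.
Proof.
have B0 : 0 <= B by apply: le_trans (normr_ge0 _) (alpha_le 0).
elim: l1 l2 => [|s l1 IH] l2 r1 r2; first by rewrite on_reduced_catrev //; lia.
case: l2 r2 => [|t l2] r2; first by rewrite on_reduced_catrev ?reduced_catrev //; lia.
have [st|st] := eqVneq s.1 t.1; last first.
  by rewrite on_reduced_catrev ?reduced_catrev //; lia.
have merge : (letter a b s * letter a b t)%g =
    expgz (if s.1 then a else b) (s.2 + t.2) by rewrite /letter -st expgzD.
rewrite word_value_rev_cons word_value_cons -mulgA [in X in (_ * X)%g]mulgA.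
rewrite merge !word_weight_cons.
have [z|z] := eqVneq (s.2 + t.2) 0.
  rewrite z mul1g; have := IH l2 (reduced_behead r1) (reduced_behead r2).
  have -> : weight t = - weight s.
    by rewrite -weight_opp /weight /= st; have -> : t.2 = - s.2 by lia.
  by move: (f _) (weight s) (word_weight l1) (word_weight l2) => *; lia.
set u := (s.1, s.2 + t.2).
have -> : (expgz (if s.1 then a else b) (s.2 + t.2) * word_value a b l2)%g
          = word_value a b (u :: l2) by rewrite word_value_cons.
(* Merging replaces the weights of [s] and [t] by that of [u]: three weights, whence the constant
   3. *)
rewrite on_reduced_catrev ?word_weight_cons.
  by have := weight_le s; have := weight_le t; have := weight_le u; lia.
apply: reduced_catrev; first exact: reduced_behead r1.
  by move: r2; rewrite /= z -st => /andP[].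
by case: l1 r1 {IH} => //= v l1 /and3P[_]; rewrite eq_sym.
Qed.

Hypothesis ab_free : free_generators a b.

Lemma on_words_defect x y : `|f (x * y)%g - f x - f y| <= 3 * B.
Proof.
have [l1 r1 ->] := free_is_word ab_free x.
have [l2 r2 ->] := free_is_word ab_free y.
have := on_words_defect_rev (reduced_rev r1) r2.
by rewrite revK !on_reduced // word_weight_rev.
Qed.

(** Inversion reverses the word and negates the exponents, and the weights are odd. *)
Lemma on_words_inv x : f (x^-1)%g = - f x.
Proof.
have [l r ->] := free_is_word ab_free x.
rewrite -word_value_neg !on_reduced //; last by apply/reduced_rev/reduced_neg.
rewrite word_weight_rev /word_weight big_map -sumrN.
by apply: eq_bigr => s _; apply: weight_opp.
Qed.

(** The power is already a word in normal form, so nothing cancels and there is no defect. *)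
Lemma on_words_powers m n k : m != 0 -> n != 0 ->
  f ((expgz a m * expgz b n) ^+ k)%g = (alpha m + beta n) *+ k.
Proof.
move=> m0 n0; have := hf (k := k) (n := fun=> m) (m := fun=> n).
by rewrite prodg_const sumr_const card_ord; apply.
Qed.

Lemma on_words_a m : f (expgz a m) = alpha m.
Proof.
have := hf (k := 1) (n := fun=> m) (m := fun=> 0).
by rewrite !big_ord1 /= mulg1 beta0 addr0; apply; case.
Qed.

Lemma on_words_b m : f (expgz b m) = beta m.
Proof.
have := hf (k := 1) (n := fun=> 0) (m := fun=> m).
by rewrite !big_ord1 /= mul1g alpha0 add0r; apply; case.
Qed.

Lemma on_words_centralizer_a x n : (x * a = a * x)%g -> `|f (x ^+ n)%g| <= B.
Proof.
case/(free_centralizer ab_free) => m ->.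
by rewrite expgzM on_words_a.
Qed.

Lemma on_words_centralizer_b x n : (x * b = b * x)%g -> `|f (x ^+ n)%g| <= B.
Proof.
case/(free_centralizer (free_generatorsC ab_free)) => m ->.
by rewrite expgzM on_words_b.
Qed.

Lemma on_words_mul_centralizers x y n : (x * a = a * x)%g -> (y * b = b * y)%g ->
  x <> 1%g -> y <> 1%g -> f ((x * y) ^+ n)%g = (f x + f y) *+ n.
Proof.
case/(free_centralizer ab_free) => m ->.
case/(free_centralizer (free_generatorsC ab_free)) => k -> m1 k1.
rewrite on_words_powers ?on_words_a ?on_words_b //.
  by apply/eqP => m0; apply: m1; rewrite m0.
by apply/eqP => k0; apply: k1; rewrite k0.
Qed.

Lemma on_words_separated_a (ys : seq F) : finite_set [set n | alpha n = 0] ->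
  (forall y, y \in ys -> (y * a = a * y)%g) ->
  exists2 x, (x * a = a * x)%g & forall y, y \in ys -> f (y^-1 * x)%g <> 0.
Proof.
case/finite_seqP => s hs hys.
have [C hC] : exists C, forall m, m \in s -> `|m| <= C.
  elim: s {hs} => [|m s [C hC]]; first by exists 0.
  by exists (`|m| + `|C|) => k; rewrite inE => /orP[/eqP->|/hC]; lia.
have [|D hD] := @expgz_seq_bound F a ys.
  by move=> y /hys /(free_centralizer ab_free).
(* Subtracting an exponent of absolute value at most [D] leaves more than [C], beyond every zero of
   [alpha]. *)
exists (expgz a (`|C| + `|D| + 1)); first exact: expgz_comm.
move=> y /hD[m -> mD]; rewrite -expgzN -expgzD on_words_a => e.
have /hC : - m + (`|C| + `|D| + 1) \in s.
  by have : [set n | alpha n = 0] (- m + (`|C| + `|D| + 1)) by []; rewrite hs.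
lia.
Qed.

End OnWords.

(** * Saturation *)

Lemma In_mem (T : eqType) (x : T) (s : seq T) : List.In x s <-> x \in s.
Proof.
elim: s => [|y s IH] //=; rewrite inE; split.
  by case=> [->|/IH ->]; rewrite ?eqxx ?orbT.
by case/orP => [/eqP->|/IH]; [left | right].
Qed.

(** [List.In] asks for no decidable equality, which formulas lack; [{classic T}] provides one for
    [finite_seqP]. *)
Lemma finite_set_list (T : Type) (A : set T) :
  finite_set A -> exists l, forall x, A x <-> List.In x l.
Proof.
case/(@finite_seqP {classic T}) => s ->; exists s => x.
by rewrite (@In_mem {classic T}).
Qed.

(** The second conjunct excludes spurious entries, so that every chosen element inherits what [R]
    says of it. *)
Lemma list_choice (T U : Type) (R : T -> U -> Prop) (l : seq T) :
  (forall x, List.In x l -> exists y, R x y) ->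
  exists l', (forall x, List.In x l -> exists2 y, List.In y l' & R x y) /\
             (forall y, List.In y l' -> exists2 x, List.In x l & R x y).
Proof.
elim: l => [|x l IH] h; first by exists [::].
have [|l' [h1 h2]] := IH; first by move=> z zl; apply: h; right.
have [y Ry] := h x (or_introl erefl).
exists (y :: l'); split=> z /= [<-|].
- by exists y; [left|].
- by case/h1 => t ? ?; exists t; [right|].
- by exists x; [left|].
- by case/h2 => t ? ?; exists t; [right|].
Qed.

Lemma smaller_range (T K : Type) (g : nat -> T) :
  smaller [set: nat] K -> smaller (range g) K.
Proof. by move=> h le; apply: h; apply: card_le_trans le (card_image_le _ _). Qed.

Lemma smaller_set0 (T K : Type) : smaller [set: nat] K -> smaller (@set0 T) K.
Proof. by move=> h le; apply: h; apply: card_le_trans le (card_ge0 _ _). Qed.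

Section Assignments.
Variables (car : sort2 -> Type).
Implicit Types (v w : assignment car).

Lemma upd_same v s n (x : car s) : upd v n x s n = x.
Proof. by case: s x => x /=; rewrite eqxx. Qed.

Lemma upd_other v s n (x : car s) s' n' :
  ~ (s' = s /\ n' = n) -> upd v n x s' n' = v s' n'.
Proof.
by case: s x; case: s' => x //= h; case: eqP => // e; case: h.
Qed.

Lemma assignmentP v w : (forall s n, v s n = w s n) -> v = w.
Proof.
by move=> h; apply: functional_extensionality_dep => s; apply: funext => n.
Qed.

End Assignments.

Section Formulas.
Local Open Scope card_scope.
Variable L : language.
Implicit Types (phi psi : formula L).

Definition Neg phi := Imp phi (Bot L).
Definition And phi psi := Neg (Imp phi (Neg psi)).
Definition Or phi psi := Imp (Neg phi) psi.
Definition Ex s n phi := Neg (All s n (Neg phi)).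
Definition conjs (l : seq (formula L)) := foldr And (Neg (Bot L)) l.
Definition disjs (l : seq (formula L)) := foldr Or (Bot L) l.
Definition alls (l : seq nat) phi := foldr (fun n psi => All SF n psi) phi l.

Variable N : structure L.
Implicit Types (v w : assignment N).

Lemma sat_Imp v phi psi : sat v (Imp phi psi) <-> (sat v phi -> sat v psi).
Proof. by []. Qed.

Lemma sat_Neg v phi : sat v (Neg phi) <-> ~ sat v phi.
Proof. by []. Qed.

Lemma sat_And v phi psi : sat v (And phi psi) <-> sat v phi /\ sat v psi.
Proof.
split=> [h|[h1 h2] h]; last exact: h.
by split; apply: contrapT => n; apply: h.
Qed.

Lemma sat_Or v phi psi : sat v (Or phi psi) <-> sat v phi \/ sat v psi.
Proof.
split=> [h|[h|h] n] //=; last by case: n.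
by have [|n] := EM (sat v phi); [left | right; apply: h].
Qed.

Lemma sat_Ex v s n phi : sat v (Ex s n phi) <-> exists x : N s, sat (upd v n x) phi.
Proof.
split=> [h|[x hx] h]; last exact: h hx.
by apply: contrapT => k; apply: h => x hx; apply: k; exists x.
Qed.

Lemma sat_conjs v l : sat v (conjs l) <-> forall phi, List.In phi l -> sat v phi.
Proof.
elim: l => [|psi l IH]; first by split=> // _ [].
rewrite [conjs _]/= sat_And IH; split=> [[h1 h2] phi /= [<-|/h2]|h] //.
by split=> [|phi hp]; apply: h; [left | right].
Qed.

Lemma sat_conjs_map (T : eqType) (g : T -> formula L) (s : seq T) v :
  sat v (conjs (map g s)) <-> forall x, x \in s -> sat v (g x).
Proof.
elim: s => [|y s IH]; first by split=> [_ x|_].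
rewrite [conjs _]/= sat_And IH; split=> [[h1 h2] x|h].
  by rewrite inE => /orP[/eqP->|/h2].
by split=> [|x xs]; apply: h; rewrite inE ?eqxx // xs orbT.
Qed.

Lemma sat_disjs_map (T : eqType) (g : T -> formula L) (s : seq T) v :
  sat v (disjs (map g s)) <-> exists2 x, x \in s & sat v (g x).
Proof.
elim: s => [|y s IH]; first by split=> [|[x]].
rewrite [disjs _]/= sat_Or IH; split=> [[h|[x h1 h2]]|[x + h]].
- by exists y; rewrite ?mem_head.
- by exists x => //; rewrite inE h1 orbT.
- by rewrite inE => /orP[/eqP<-|xs]; [left | right; exists x].
Qed.

(** Speaking of assignments that differ from [v] only on [l] avoids nested updates. *)
Lemma sat_alls l v phi : sat v (alls l phi) <->
  forall w, w SZ = v SZ -> (forall n, n \notin l -> w SF n = v SF n) -> sat w phi.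
Proof.
elim: l v => [|m l IH] v /=.
  split=> [h w e1 e2|h]; last exact: h.
  by have -> : w = v by apply: assignmentP => -[] n; rewrite ?e1 ?e2.
split=> [h w e1 e2|h x]; last first.
  apply/IH => w e1 e2; apply: h => // n.
  rewrite inE negb_or => /andP[/negbTE nm /e2 ->] /=; by rewrite nm.
have /IH := h (w SF m); apply => //= n nl; case: eqP => [-> //|/eqP nm].
by apply: e2; rewrite inE negb_or nm.
Qed.

Lemma teval_ext v w s (t : term L s) :
  (forall s' n', tfv t s' n' -> v s' n' = w s' n') -> teval v t = teval w t.
Proof.
elim: t => [s' n|g ts IH] h /=; first exact: h.
have -> // : (fun i => teval v (ts i)) = (fun i => teval w (ts i)).
apply: functional_extensionality_dep => i.
by apply: IH => s' n' hi; apply: h; exists i.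
Qed.

Lemma sat_ext phi v w :
  (forall s n, fv phi s n -> v s n = w s n) -> sat v phi <-> sat w phi.
Proof.
elim: phi v w => [s t u|r ts||phi IH1 psi IH2|s n phi IH] v w h /=.
- have -> : teval v t = teval w t by apply: teval_ext => *; apply: h; left.
  by have -> : teval v u = teval w u by apply: teval_ext => *; apply: h; right.
- have -> // : (fun i => teval v (ts i)) = (fun i => teval w (ts i)).
  apply: functional_extensionality_dep => i.
  by apply: teval_ext => s' n' k; apply: h; exists i.
- by [].
- have e1 : sat v phi <-> sat w phi by apply: IH1 => s n k; apply: h; left.
  have e2 : sat v psi <-> sat w psi by apply: IH2 => s n k; apply: h; right.
  by split=> k /e1 /k /e2.
- have e (x : N s) : sat (upd v n x) phi <-> sat (upd w n x) phi.
    apply: IH => s' n' hf; have [[e1 e2]|ne] := EM (s' = s /\ n' = n).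
      by subst s' n'; rewrite !upd_same.
    by rewrite !upd_other //; apply: h.
  by split=> k x; apply/e; apply: k.
Qed.

(* One-variable saturation is used twice: for the existential closures of the
   finite conjunctions, and then over the element found. *)
Lemma saturated_pair (K : Type) v (Gamma : set (formula L)) :
  smaller [set: nat] K -> saturated K N ->
  (forall l, (forall phi, List.In phi l -> Gamma phi) ->
     exists (x : N SF) (y : N SZ),
     forall phi, List.In phi l -> sat (upd (upd v 0 x) 0 y) phi) ->
  exists (x : N SF) (y : N SZ),
  forall phi, Gamma phi -> sat (upd (upd v 0 x) 0 y) phi.
Proof.
move=> K_gt hN hfin.
have small w s : smaller (range (w s : nat -> N s)) K by apply: smaller_range.
have over_range w s phi : Defs.over (fun s => range (w s)) s (phi, w).
  by move=> s' n _ _; exists n.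
pose sub l := forall phi, List.In phi l -> Gamma phi.
pose p1 := [set q | exists2 l, sub l & q = (Ex SZ 0 (conjs l), v)].
have [|p0 fp0 p01|x hx] := hN (fun s => range (v s)) (small v) SF p1.
- by move=> q [l _ ->].
- have [lq hlq] := finite_set_list fp0.
  have [|ls [h1 h2]] := @list_choice _ _ (fun q l => sub l /\
      q = (Ex SZ 0 (conjs l), v)) lq.
    by move=> q /hlq /p01 [l ? ?]; exists l.
  (* One pair satisfying all the finitely many conjunctions at once makes its first component a
     common witness. *)
  have [|x [y hxy]] := hfin (List.concat ls).
    move=> phi /List.in_concat[l [/h2[q _ [hl _]] ]]; exact: hl.
  exists x => q /hlq /h1 [l hl [_ ->]].
  apply/sat_Ex; exists y; apply/sat_conjs => phi hphi; apply: hxy.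
  by apply/List.in_concat; exists l.
pose w := upd v 0 x.
pose p2 := [set q | exists2 phi, Gamma phi & q = (phi, w)].
have [|p0 fp0 p02|y hy] := hN (fun s => range (w s)) (small w) SZ p2.
- by move=> q [phi _ ->].
- have [lq hlq] := finite_set_list fp0.
  have [|l [h1 h2]] := @list_choice _ _ (fun q phi => Gamma phi /\ q = (phi, w)) lq.
    by move=> q /hlq /p02 [phi ? ?]; exists phi.
  have /hx : p1 (Ex SZ 0 (conjs l), v).
    by exists l => // phi /h2 [q _ []].
  case/sat_Ex => y /sat_conjs hy; exists y => q /hlq /h1 [phi hl [_ ->]].
  exact: hy.
by exists x, y => phi hphi; apply: (hy (phi, w)); exists phi.
Qed.

(* A maximal separated set containing u cannot be small, since saturation would
   yield a further element. *)
Lemma saturated_separated (K : Type) v (u : N SF) (G : set (N SF))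
    (W : N SF -> N SF -> Prop) (gamma theta : formula L) :
  smaller [set: nat] K -> saturated K N -> G u ->
  (forall s n, fv gamma s n -> s = SF /\ (n = 0 \/ n = 2)) ->
  (forall w, w SF 2 = u -> sat w gamma <-> G (w SF 0)) ->
  (forall s n, fv theta s n -> s = SF /\ (n = 0 \/ n = 3)) ->
  (forall w, sat w theta <-> W (w SF 3) (w SF 0)) ->
  (forall y, ~ W y y) ->
  (forall l, (forall y, List.In y l -> G y) ->
     exists2 x, G x & forall y, List.In y l -> W y x) ->
  exists A : set (N SF), [/\ A `<=` G, [set: K] #<= A &
    forall x y, A x -> A y -> x <> y -> W x y \/ W y x].
Proof.
move=> K_gt hN Gu fvg hg fvt ht Wirr hfin.
pose sep (A : set (N SF)) := forall x y, A x -> A y -> x <> y -> W x y \/ W y x.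
(* [u] is adjoined rather than required to be a member, because Zorn's lemma also tests the empty
   chain, whose union is empty. *)
pose P (A : set (N SF)) := A `<=` G /\ sep (A `|` [set u]).
have [C CP Ctot|A [[AG Asep] Amax]] := @Zorn_bigcup _ P.
  split=> [x [B CB Bx]|x y].
    by have [BG _] := CP B CB; apply: BG.
  move=> [[B1 C1 x1]|xu] [[B2 C2 y2]|yu] xy.
  - case: (Ctot B1 B2 C1 C2) => le.
      by apply: (CP B2 C2).2 => //; left=> //; apply: le.
    by apply: (CP B1 C1).2 => //; left=> //; apply: le.
  - by apply: (CP B1 C1).2 => //; [left|right].
  - by apply: (CP B2 C2).2 => //; [right|left].
  - by rewrite xu yu in xy.
exists (A `|` [set u]); split=> //; first by move=> x [/AG|->].
apply: contrapT => Asmall.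
pose D s : set (N s) := match s with SF => A `|` [set u] | SZ => set0 end.
(* The type of an element of [G] separated from all members found so far; having [u] among them
   makes it an admissible parameter of [gamma]. *)
pose p := [set q | q = (gamma, upd v 2 u) \/
                   exists2 y, (A `|` [set u]) y & q = (theta, upd v 3 y)].
have DS s : smaller (D s) K by case: s => //; apply: smaller_set0.
have [q|p0 fp0 p0p|x hx] := hN D DS SF p.
- case=> [->|[y Ay ->]] s n /=.
    by case/fvg => -> [->|->] h; [case: h | right].
  by case/fvt => -> [->|->] h; [case: h | ].
- have [lq hlq] := finite_set_list fp0.
  pose R q y := (A `|` [set u]) y /\
                (q = (gamma, upd v 2 u) \/ q = (theta, upd v 3 y)).
  have [|ys [h1 h2]] := @list_choice _ _ R lq.
    move=> q /hlq /p0p [->|[y Ay ->]]; first by exists u; split; [right|left].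
    by exists y; split=> //; right.
  have [|x Gx Wx] := hfin ys.
    by move=> y /h2 [q _ [[/AG|->]]].
  exists x => q /hlq /h1 [y hy [_ [->|->]]].
    by apply/hg.
  by apply/ht; apply: Wx.
have Gx : G x.
  have /hx h : p (gamma, upd v 2 u) by left.
  by apply: (hg _ _).1 h.
have Wx y : (A `|` [set u]) y -> W y x.
  move=> Ay; have /hx h : p (theta, upd v 3 y) by right; exists y.
  exact: (ht _).1 h.
have nAx : ~ A x by move=> Ax; apply: (Wirr x); apply: Wx; left.
apply: (Amax (A `|` [set x])).
  by split=> [y|le]; [left | apply: nAx; apply: le; right].
split=> [y [/AG|->]//|y z].
move=> [[Ay|->]|yu] [[Az|->]|zu] yz //.
- by apply: Asep => //; left.
- by left; apply: Wx; left.
- by apply: Asep => //; [left|right].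
- by right; apply: Wx; left.
- by right; apply: Wx; right.
- by apply: Asep => //; [right|left].
- by left; apply: Wx; right.
- by rewrite yu zu in yz.
Qed.

End Formulas.

(** * Formulas in the base language *)

(** Pigeonhole: if the elements [i x] with [x] in [A] lay in distinct cosets, there would be at
    least |K| cosets. *)
Lemma coset_collision (K T : Type) (G : groupType) (H S : set G) (A : set T)
    (i : T -> G) :
  is_subgroup S -> bounded_index K H S -> ([set: K] #<= A)%card ->
  (forall x, A x -> H (i x)) ->
  exists x y, [/\ A x, A y, x <> y & S ((i x)^-1 * i y)%g].
Proof.
move=> [S1 _ _] bounded large iH; apply: contrapT => no.
pose c x := [set (i x * z)%g | z in S].
have c_inj : {in A &, injective c}.
  move=> x y /set_mem Ax /set_mem Ay cxy; apply: contrapT => xy; apply: no.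
  exists x, y; split=> //.
  have : c y (i y) by exists 1%g; rewrite ?mulg1.
  by rewrite -cxy => -[z Sz <-]; rewrite mulKg.
apply: bounded; apply: card_le_trans large _.
rewrite -(card_le_eql (inj_card_eq c_inj)).
by apply: subset_card_le => _ [x Ax <-]; exists (i x) => //; apply: iH.
Qed.

Section BaseFormulas.
Local Open Scope ring_scope.
Variable E : language.
Local Notation L := (sum_language base_language E).

Definition tmul (t u : term L SF) : term L SF :=
  @App L (inl Fmul) (fun i : 'I_2 => if i == ord0 then t else u).

Definition tadd (t u : term L SZ) : term L SZ :=
  @App L (inl Zadd) (fun i : 'I_2 => if i == ord0 then t else u).

Definition tf (t : term L SF) : term L SZ := @App L (inl FtoZ) (fun i : 'I_1 => t).

(** The exponent is [n.+1], since the base language has no constant for the neutral element;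
    likewise for [taddn]. *)
Definition tpow (t : term L SF) n : term L SF := iter n (tmul t) t.

Definition taddn (t : term L SZ) n : term L SZ := iter n (tadd t) t.

(* The variables of positive index of sort SZ serve as names for the integers. *)
Definition zvar (e : int) : term L SZ := Var L SZ (pickle e).+1.

Definition int_range (n : nat) : seq int :=
  [seq (i%:Z - n%:Z) | i <- iota 0 (n + n).+1].

Lemma mem_int_range n e : e \in int_range n = (`|e| <= n%:Z).
Proof.
apply/mapP/idP => [[i]|h]; first by rewrite mem_iota => h ->; lia.
by exists (absz (e + n%:Z)); [rewrite mem_iota; lia | lia].
Qed.

(** When each [zvar e] names [e], this says that [t - u] is a standard integer of absolute value at
    most [n]. The disjunction is finite, hence first-order, and so survives transfer. *)
Definition within n (t u : term L SZ) : formula L :=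
  disjs [seq Eq t (tadd (zvar e) u) | e <- int_range n].

Definition comm_formula (t u : term L SF) : formula L := Eq (tmul t u) (tmul u t).

(** Variables 0 and 1 of sort [SF] are left to be overwritten, 2 and 3 hold the parameters [u] and
    [u'], and the integer variables decode the names [zvar]. *)
Definition assign (F : groupType) (Z : zmodType) (u u' : F) (val : int -> Z) :
    assignment (carrier F Z) :=
  fun s => match s return nat -> carrier F Z s with
    | SF => fun n => if n == 2%N then u else u'
    | SZ => fun n => val (odflt 0 (unpickle n.-1))
    end.

Section Semantics.
Variables (F : groupType) (Z : zmodType) (f : F -> Z) (J : interp E (carrier F Z)).
Local Notation N := (expansion f J).
Implicit Types (v : assignment N).

Lemma teval_add v (t u : term L SZ) : teval v (tadd t u) = teval v t + teval v u.
Proof. by []. Qed.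

Lemma teval_f v (t : term L SF) : teval v (tf t) = f (teval v t).
Proof. by []. Qed.

Lemma teval_pow v (t : term L SF) n : teval v (tpow t n) = ((teval v t : F) ^+ n.+1)%g.
Proof. by elim: n => [//|n IH]; rewrite expgS -IH. Qed.

Lemma teval_addn v (t : term L SZ) n : teval v (taddn t n) = (teval v t : Z) *+ n.+1.
Proof. by elim: n => [//|n IH]; rewrite mulrS -IH. Qed.

Lemma sat_within (val : int -> Z) v n (t u : term L SZ) :
  (forall e, teval v (zvar e) = val e) ->
  sat v (within n t u) <->
  exists2 e, `|e| <= n%:Z & teval v t = val e + teval v u.
Proof.
move=> hv; rewrite sat_disjs_map; split=> -[e].
  by rewrite mem_int_range => h; rewrite /sat teval_add hv; exists e.
by rewrite -mem_int_range => h k; exists e; rewrite // /sat teval_add hv.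
Qed.

Lemma sat_comm v (t u : term L SF) :
  sat v (comm_formula t u) <-> (teval v t * teval v u = teval v u * teval v t)%g.
Proof. by []. Qed.

Lemma assign_zvar (u u' x y : F) (val : int -> Z) e :
  teval (N := N) (upd (upd (assign u u' val) (s := SF) 0 x) (s := SF) 1 y) (zvar e)
  = val e.
Proof. by rewrite -[LHS]/(val (odflt 0 (unpickle (pickle e)))) pickleK. Qed.

End Semantics.
End BaseFormulas.

(** * Transfer to the monster model *)

Section Transfer.
Local Open Scope ring_scope.
Variables (F0 : groupType) (f0 : F0 -> int) (E : language)
  (J0 : interp E (carrier F0 int)).
Variables (F : groupType) (Z : zmodType) (f : F -> Z) (J : interp E (carrier F Z)).
Variable j : forall s : sort2, carrier F0 int s -> carrier F Z s.
Arguments j : clear implicits.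
Local Notation M := (expansion f0 J0).
Local Notation N := (expansion f J).
Local Notation L := (sum_language base_language E).
Hypothesis he : elementary_embedding (M := M) (N := N) j.

Local Notation jF := (j SF : F0 -> F).
Local Notation jZ := (j SZ : int -> Z).
Local Notation x_ := (Var L SF 0).
Local Notation y_ := (Var L SF 1).
Local Notation u_ := (Var L SF 2).
Local Notation u'_ := (Var L SF 3).

Lemma map_assign (u u' : F0) :
  (fun s n => j s (assign u u' id s n : carrier F0 int s)) = assign (jF u) (jF u') jZ.
Proof. by apply: (@assignmentP (carrier F Z)) => -[] n //=; case: ifP. Qed.

Lemma transfer_pair (u u' : F0) (phi : formula L) :
  (forall x y : F0,
     sat (N := M) (upd (upd (assign u u' id) (s := SF) 0 x) (s := SF) 1 y) phi) ->
  forall x y : F,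
    sat (N := N) (upd (upd (assign (jF u) (jF u') jZ) (s := SF) 0 x)
                      (s := SF) 1 y) phi.
Proof.
move=> h x y; have [/(_ h)] := he (All SF 0 (All SF 1 phi)) (assign u u' id).
by rewrite (map_assign u u') => hN _; apply: hN.
Qed.

Lemma elementary_addZ e e' : jZ (e + e') = jZ e + jZ e'.
Proof.
pose v : assignment M := fun s => match s return nat -> carrier F0 int s with
  | SF => fun=> 1%g | SZ => fun n => nth 0 [:: e; e'; e + e'] n end.
by have [/(_ erefl)] := he (Eq (Var L SZ 2) (tadd (Var L SZ 0) (Var L SZ 1))) v.
Qed.

Lemma elementary_injZ : injective jZ.
Proof.
move=> e e' ee'.
pose v : assignment M := fun s => match s return nat -> carrier F0 int s with
  | SF => fun=> 1%g | SZ => fun n => nth 0 [:: e; e'] n end.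
by have [_ ] := he (Eq (Var L SZ 0) (Var L SZ 1)) v; apply.
Qed.

Lemma elementary0 : jZ 0 = 0.
Proof. by apply: (addrI (jZ 0)); rewrite -elementary_addZ !addr0. Qed.

Lemma elementary_opp e : jZ (- e) = - jZ e.
Proof. by apply: (addrI (jZ e)); rewrite -elementary_addZ !subrr elementary0. Qed.

Lemma elementary_odd : (forall x, f0 (x^-1)%g = - f0 x) ->
  forall x, f (x^-1)%g = - f x.
Proof.
move=> odd x.
(* Inverse and opposite are expressed without symbols for them: x y x = x says that y is the inverse
   of x, and f x + (f y + f x) = f x that f y is the opposite of f x. *)
pose phi : formula L := Imp (Eq (tmul x_ (tmul y_ x_)) x_)
  (Eq (tadd (tf x_) (tadd (tf y_) (tf x_))) (tf x_)).
have h := @transfer_pair 1%g 1%g phi _ x (x^-1)%g.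
apply: (addrI (f x)); rewrite subrr; apply: (addIr (f x)); rewrite add0r -addrA.
apply: h; last by rewrite /= mulVg mulg1.
move=> y z /= e; have -> : z = (y^-1)%g.
  by apply: (mulgI y); rewrite mulgV; apply: (mulIg y); rewrite mul1g -mulgA.
by rewrite odd; lia.
Qed.

(** The defect ranges over finitely many integers, so it stays a standard integer in the
    extension. *)
Lemma elementary_defect n : (forall x y, `|f0 (x * y)%g - f0 x - f0 y| <= n%:Z) ->
  forall x y, exists2 e, `|e| <= n%:Z & f x + f y = jZ e + f (x * y)%g.
Proof.
move=> defect x y.
pose phi : formula L := within n (tadd (tf x_) (tf y_)) (tf (tmul x_ y_)).
have h := @transfer_pair 1%g 1%g phi _ x y.
apply: (sat_within _ _ _ (@assign_zvar _ _ _ _ _ _ _ _ _ _)).1 (h _).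
move=> z t; apply: (sat_within _ _ _ (@assign_zvar _ _ _ _ _ _ _ _ _ _)).2.
exists (f0 z + f0 t - f0 (z * t)%g); last by rewrite /= subrK.
by have := defect z t; move: (f0 z) (f0 t) (f0 _) => *; lia.
Qed.

(** Each [k] gives one formula, and the finite range of values does not grow with [k]. *)
Lemma elementary_centralizer (u : F0) n :
  (forall x k, (x * u = u * x)%g -> `|f0 (x ^+ k)%g| <= n%:Z) ->
  forall x k, (x * jF u = jF u * x)%g ->
  exists2 e, `|e| <= n%:Z & f (x ^+ k.+1)%g = jZ e.
Proof.
move=> bound x k xu.
pose phi : formula L :=
  Imp (comm_formula x_ u_) (within n (tf (tpow x_ k)) (zvar E 0)).
have h := @transfer_pair u u phi _ x x.
have [|e le] := (sat_within _ _ _ (@assign_zvar _ _ _ _ _ _ _ _ _ _)).1 (h _ xu).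
  move=> y z yu; apply: (sat_within _ _ _ (@assign_zvar _ _ _ _ _ _ _ _ _ _)).2.
  rewrite teval_f teval_pow assign_zvar; exists (f0 (y ^+ k.+1)%g).
    exact: bound.
  by rewrite addr0.
rewrite teval_f teval_pow assign_zvar elementary0 addr0 => ?.
by exists e.
Qed.

Lemma elementary_mul_centralizers (u u' : F0) :
  (forall x y n, (x * u = u * x)%g -> (y * u' = u' * y)%g ->
     x <> 1%g -> y <> 1%g -> f0 ((x * y) ^+ n)%g = (f0 x + f0 y) *+ n) ->
  forall x y n, (x * jF u = jF u * x)%g -> (y * jF u' = jF u' * y)%g ->
    x <> 1%g -> y <> 1%g -> f ((x * y) ^+ n.+1)%g = (f x + f y) *+ n.+1.
Proof.
move=> hyp x y n xu yu x1 y1.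
(* Being nontrivial is expressed as x x <> x, again for want of a constant. *)
pose phi : formula L := Imp (comm_formula x_ u_) (Imp (comm_formula y_ u'_)
  (Imp (Neg (Eq (tmul x_ x_) x_)) (Imp (Neg (Eq (tmul y_ y_) y_))
  (Eq (tf (tpow (tmul x_ y_) n)) (taddn (tadd (tf x_) (tf y_)) n))))).
have nt (G : groupType) (z : G) : z <> 1%g -> (z * z)%g <> z.
  by move=> z1 zz; apply: z1; apply: (mulgI z); rewrite mulg1.
have h := @transfer_pair u u' phi _ x y xu yu (nt _ _ x1) (nt _ _ y1).
move: h; rewrite /sat !teval_f teval_pow teval_addn; apply.
move=> z t zu tu z1 t1.
have zn : z <> 1%g by move=> e; apply: z1; rewrite /= e mulg1.
have tn : t <> 1%g by move=> e; apply: t1; rewrite /= e mulg1.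
by rewrite /sat !teval_f teval_pow teval_addn; apply: hyp.
Qed.

End Transfer.

(** * Separated elements in centralizers of the monster model *)

Section Separation.
Local Open Scope ring_scope.
Variable E : language.
Local Notation L := (sum_language base_language E).
Local Notation x_ := (Var L SF 0).
Local Notation y_ := (Var L SF 1).
Local Notation u_ := (Var L SF 2).

Variable q : formula L.
Hypothesis fv_q : forall s n, fv q s n -> s = SF /\ n = 1%N.

(* The language has no symbol for inverses: the quotient of the variables i and
   0 is the z with x_i z = x_0. *)
Definition quotient_formula i : formula L :=
  All SF 1 (Imp (Eq (tmul (Var L SF i) y_) x_) q).

Lemma tfv_mul (t t' : term L SF) s n :
  tfv (tmul t t') s n -> tfv t s n \/ tfv t' s n.
Proof. by case=> i; case: ifP; [left | right]. Qed.

Lemma tfv_add (t t' : term L SZ) s n :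
  tfv (tadd t t') s n -> tfv t s n \/ tfv t' s n.
Proof. by case=> i; case: ifP; [left | right]. Qed.

Lemma tfv_f (t : term L SF) s n : tfv (tf t) s n -> tfv t s n.
Proof. by case. Qed.

Lemma fv_quotient i s n : fv (quotient_formula i) s n ->
  s = SF /\ (n = 0%N \/ n = i).
Proof.
case=> -[[/tfv_mul[]|]|/fv_q] h ne.
- by case: h => -> ->; split; last right.
- by case: ne.
- by case: h => -> ->; split; last left.
- by case: ne.
Qed.

Lemma sat_quotient (F : groupType) (Z : zmodType) (f : F -> Z)
    (J : interp E (carrier F Z)) (Q : F -> Prop) :
  (forall w : assignment (expansion f J), sat w q <-> Q (w SF 1%N)) ->
  forall (w : assignment (expansion f J)) i, (1 < i)%N ->
  sat w (quotient_formula i) <-> Q ((w SF i : F)^-1 * (w SF 0%N : F))%g.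
Proof.
move=> hq w [|[|i]] // _; split.
  by move/(_ ((w SF i.+2 : F)^-1 * (w SF 0%N : F))%g) => /= /(_ (mulVKg _ _)) /hq.
move=> h z /= e; apply/hq => /=.
by have -> : z = ((w SF i.+2 : F)^-1 * (w SF 0%N : F))%g by rewrite -e mulKg.
Qed.

(** Variables 3 to k + 2 hold the given points and 2 holds the element centralized; for a fixed
    number of points, separation is a single formula. *)
Definition separation_formula k : formula L :=
  Imp (conjs [seq comm_formula (Var L SF i) u_ | i <- iota 3 k])
      (Ex SF 0 (And (comm_formula x_ u_)
                    (conjs [seq quotient_formula i | i <- iota 3 k]))).

Lemma elementary_separated (F0 : groupType) (f0 : F0 -> int)
    (J0 : interp E (carrier F0 int)) (F : groupType) (Z : zmodType) (f : F -> Z)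
    (J : interp E (carrier F Z))
    (j : forall s : sort2, carrier F0 int s -> carrier F Z s)
    (Q0 : F0 -> Prop) (Q : F -> Prop) (u : F0) :
  elementary_embedding (M := expansion f0 J0) (N := expansion f J) j ->
  (forall w : assignment (expansion f0 J0), sat w q <-> Q0 (w SF 1%N)) ->
  (forall w : assignment (expansion f J), sat w q <-> Q (w SF 1%N)) ->
  (forall ys : seq F0, (forall y, y \in ys -> (y * u = u * y)%g) ->
     exists2 x, (x * u = u * x)%g & forall y, y \in ys -> Q0 (y^-1 * x)%g) ->
  let v : F := j SF u in
  forall ys : seq F, (forall y, y \in ys -> (y * v = v * y)%g) ->
     exists2 x, (x * v = v * x)%g & forall y, y \in ys -> Q (y^-1 * x)%g.
Proof.
move=> he hq0 hq sep v ys hys; have [k kE] : {k | k = size ys} by exists (size ys).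
have := (he (alls (iota 3 k) (separation_formula k)) (assign u u id)).1.
rewrite (map_assign j u u) => h.
have {h} := h _; rewrite !sat_alls => h.
(* The list is stored from variable 3 on. The default [v] of [nth] agrees with [assign v v], so [w]
   differs from it only on the quantified variables. *)
pose w : assignment (expansion f J) := fun s => match s return nat -> carrier F Z s with
  | SF => fun n => if (2 < n)%N then nth v ys (n - 3) else v
  | SZ => assign v v (j SZ) SZ end.
have : sat w (Ex SF 0 (And (comm_formula x_ u_)
    (conjs [seq quotient_formula i | i <- iota 3 k]))).
  apply: (h _ w).
  - move=> {h hys}w0 _ e2.
    have w2 : w0 SF 2%N = u by rewrite e2 // mem_iota.
    apply/sat_Imp => /sat_conjs_map hc; apply/sat_Ex.
    have [|x xu hx] := sep [seq w0 SF i | i <- iota 3 k].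
      by move=> y /mapP[i /hc + ->]; rewrite sat_comm /= w2.
    exists x; apply/sat_And; split; first by rewrite sat_comm /= w2.
    apply/sat_conjs_map => i ik; apply/(sat_quotient hq0).
      by move: ik; rewrite mem_iota => /andP[/ltnW].
    rewrite upd_same upd_other; last first.
      by case=> _ i0; move: ik; rewrite i0 mem_iota.
    by apply: hx; apply: map_f.
  - by [].
  - move=> n; rewrite mem_iota negb_and -ltnNge -leqNgt => /orP[|] h3 /=.
      by rewrite ltnNge -ltnS h3 if_same.
    have hk : (size ys <= n - 3)%N by move: h3; rewrite -kE; lia.
    by rewrite (nth_default _ hk) !if_same.
  - apply/sat_conjs_map => i; rewrite mem_iota => /andP[i3 ik].
    rewrite sat_comm /= i3; apply/hys/mem_nth; rewrite -kE.
    by move: (i : nat) i3 ik => n; lia.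
move/sat_Ex => [x /sat_And[xv /sat_conjs_map hx]]; exists x => // y yys.
have iy : (index y ys + 3)%N \in iota 3 k.
  by rewrite mem_iota; have := yys; rewrite -index_mem -kE; lia.
have /(sat_quotient hq) := hx _ iy.
rewrite upd_same upd_other; last by case=> _; lia.
rewrite /w; have -> : (2 < index y ys + 3)%N by lia.
by rewrite addnK nth_index //; apply; lia.
Qed.

(** Saturation yields at least |K| elements of the centralizer that are pairwise separated by [Q];
    bounded index puts two of their graph points into one coset of [S]. *)
Lemma bounded_index_centralizer (K : Type) (F0 : groupType) (f0 : F0 -> int)
    (J0 : interp E (carrier F0 int)) (F : groupType) (Z : zmodType) (f : F -> Z)
    (J : interp E (carrier F Z))
    (j : forall s : sort2, carrier F0 int s -> carrier F Z s)
    (Q0 : F0 -> Prop) (Q : F -> Prop) (u : F0) (S : set (product_group F Z)) :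
  elementary_embedding (M := expansion f0 J0) (N := expansion f J) j ->
  monster K (expansion f J) ->
  (forall w : assignment (expansion f0 J0), sat w q <-> Q0 (w SF 1%N)) ->
  (forall w : assignment (expansion f J), sat w q <-> Q (w SF 1%N)) ->
  (forall ys : seq F0, (forall y, y \in ys -> (y * u = u * y)%g) ->
     exists2 x, (x * u = u * x)%g & forall y, y \in ys -> Q0 (y^-1 * x)%g) ->
  ~ Q 1%g -> is_subgroup S -> bounded_index K (generated (graph f)) S ->
  let v : F := j SF u in
  exists c y, [/\ (c * v = v * c)%g, Q c & S (c, y)].
Proof.
move=> he [K_gt _ _ hN _] hq0 hq sep Q1 hS bounded v.
have sepN := elementary_separated he hq0 hq sep.
pose G := [set x : F | (x * v = v * x)%g].
pose W (y x : F) := Q (y^-1 * x)%g.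
have [||||||l hl|A [AG Alarge Asep]] :=
  @saturated_separated _ (expansion f J) K (assign v v (j SZ)) v G W
    (comm_formula x_ u_) (quotient_formula 3) K_gt hN.
- by [].
- move=> s n /= [] /tfv_mul[] [-> ->]; split=> //;
  by [left | right].
- by move=> w wu; rewrite sat_comm /= wu.
- exact: fv_quotient.
- by move=> w; apply: sat_quotient.
- by move=> y; rewrite /W mulVg.
- have [|x xv hx] := sepN l; first by move=> y /In_mem /hl.
  by exists x => // y /In_mem; apply: hx.
have [|x [y [Ax Ay xy Sxy]]] := coset_collision
    (i := fun x : F => (x, f x) : product_group F Z) hS bounded Alarge.
  by move=> x _ B [_ XB]; apply: XB.
have xv := AG x Ax; have yv := AG y Ay.
have comm_quot (z t : F) : G z -> G t -> G (z^-1 * t)%g.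
  by move=> zv tv; apply: commute_sym; apply: commuteM; [apply: commuteV|]; apply: commute_sym.
(* Separation holds in one order only; if it is the opposite of the order of the collision, the
   element of [S] is inverted. *)
have [Wxy|Wyx] := Asep x y Ax Ay xy.
  by exists (x^-1 * y)%g; eexists; split; [apply: comm_quot|exact: Wxy|exact: Sxy].
exists (y^-1 * x)%g; eexists; split; [exact: comm_quot|exact: Wyx|].
case: hS => _ _ /(_ _ Sxy); rewrite invgM invgK.
exact.
Qed.

End Separation.

(** * The contradiction *)

Section Main.
Local Open Scope ring_scope.
Variables (E : language) (F : groupType) (Z : zmodType) (f : F -> Z)
  (J : interp E (carrier F Z)).
Local Notation N := (expansion f J).
Local Notation L := (sum_language base_language E).

(** Compactness: if no bound worked, the type of [S] together with all formulas denying a bound [n]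
    would be finitely satisfiable, and a realization would be a point of [S] at no standard distance
    from the graph. *)
Lemma type_definable_bound (K : Type) (val : int -> Z) (S : set (F * Z)) :
  smaller [set: nat] K -> saturated K N ->
  type_definable0 (N := N) S ->
  (forall x, S x -> exists e, x.2 = val e + f x.1) ->
  exists n : nat, forall x, S x -> exists2 e, `|e| <= n%:Z & x.2 = val e + f x.1.
Proof.
move=> K_gt hN [p fvp ->] hS; apply: contrapT => unbounded.
pose chi n : formula L := within n (Var L SZ 0) (tf (Var L SF 0)).
pose v0 : assignment N := assign 1%g 1%g val.
pose v x y : assignment N := upd (upd v0 (s := SF) 0 x) (s := SZ) 0 y.
have chiP x y n : sat (v x y) (chi n) <-> exists2 e, `|e| <= n%:Z & y = val e + f x.
  apply: sat_within => e.
  by rewrite -[LHS]/(val (odflt 0 (unpickle (pickle e)))) pickleK.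
have pP x y phi : p phi -> sat (v x y) phi <-> sat (pair_assignment (x, y)) phi.
  by move=> /fvp h; apply: sat_ext => -[] n /h ->.
pose Gamma := p `|` [set Neg (chi n) | n in [set: nat]].
have [l hl|x [y hxy]] := saturated_pair (v := v0) (Gamma := Gamma) K_gt hN.
  (* Larger bounds are weaker, so one [m] above all those occurring in [l] handles them
     simultaneously. *)
  have [m hm] : exists m : nat, forall phi, List.In phi l ->
      p phi \/ exists2 n, (n <= m)%N & phi = Neg (chi n).
    elim: l hl => [|phi l IH] hl; first by exists 0%N.
    have [|m hm] := IH; first by move=> psi h; apply: hl; right.
    have [pphi|[n _ <-]] := hl phi (or_introl erefl).
      by exists m => psi /= [<-|/hm]; [left|].
    exists (n + m)%N => psi /= [<-|/hm[|[k km ->]]].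
    - by right; exists n => //; rewrite leq_addr.
    - by left.
    - by right; exists k => //; lia.
  have [[x y] [Sxy far]] : exists x : F * Z,
      (forall phi, p phi -> sat (N := N) (pair_assignment x) phi) /\
      ~ exists2 e, `|e| <= m%:Z & x.2 = val e + f x.1.
    apply: contrapT => no; apply: unbounded; exists m => x Sx.
    by apply: contrapT => h; apply: no; exists x.
  exists x, y => phi /hm [pphi|[n nm ->]]; first by apply/pP/Sxy.
  by apply/sat_Neg => /chiP [e en h]; apply: far; exists e => //=; lia.
have [|e he] := hS (x, y).
  by move=> phi pphi; apply/(pP x y phi pphi)/hxy; left.
have /sat_Neg : sat (v x y) (Neg (chi (absz e))).
  by apply: hxy; right; exists (absz e).
by apply; apply/chiP; exists e => //; lia.
Qed.

(* All multiples of w - t lie in a bounded set of standard integers. *)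
Lemma subgroup_homogeneous (val : int -> Z) (S : set (product_group F Z)) (n B : nat)
    (c : F) (w t : Z) :
  injective val -> {morph val : x y / x + y} ->
  is_subgroup S ->
  (forall x, S x -> exists2 e, `|e| <= n%:Z & x.2 = val e + f x.1) ->
  S (c, w) ->
  (forall k, exists2 e, `|e| <= B%:Z & f (c ^+ k.+1)%g = val e + t *+ k.+1) ->
  w = t.
Proof.
move=> inj add [S1 SM _] hS Scw hc.
have val0 : val 0 = 0 by apply: (addrI (val 0)); rewrite -add !addr0.
have valMn e k : val (e *+ k) = val e *+ k.
  by elim: k => [|k IH]; rewrite ?mulr0n // !mulrS add IH.
have pow k : S ((c ^+ k)%g, w *+ k).
  elim: k => [//|k IH]; rewrite expgS mulrS.
  exact: (SM (c, w) ((c ^+ k)%g, w *+ k)).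
have multiple k : exists2 e, `|e| <= (n + B)%:Z & (w - t) *+ k.+1 = val e.
  have [e1 le1 /= ew] := hS _ (pow k.+1).
  have [e2 le2 ec] := hc k; exists (e1 + e2); first lia.
  by rewrite mulrnBl ew ec add addrA addrK.
have [e0 _] := multiple 0%N; rewrite mulr1n => wt.
(* This multiplies [e0] by n + B + 1, yet the result is at most n + B in absolute value, so [e0] is
   0. *)
have [e le] := multiple (n + B)%N; rewrite wt -valMn => /inj ee.
have e00 : e0 = 0 by move: le; rewrite -ee -mulr_natr; nia.
by apply/eqP; rewrite -subr_eq0 wt e00 val0.
Qed.

End Main.

(** * The graph of an odd quasimorphism and the group it generates *)

Section QuasimorphismGraph.
Local Open Scope ring_scope.
Variables (F : groupType) (Z : zmodType) (f : F -> Z) (val : int -> Z) (D : nat).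
Hypotheses (val_add : {morph val : x y / x + y})
  (f_odd : forall x, f (x^-1)%g = - f x)
  (f_defect : forall x y,
     exists2 e, `|e| <= D%:Z & f x + f y = val e + f (x * y)%g).

(** Oddness gives symmetry, and the translates by (1, val e) for the finitely many possible defects
    [e] cover the products. *)
Lemma graph_approximate_subgroup : approximate_subgroup (graph f).
Proof.
rewrite /approximate_subgroup /graph; split.
  apply/seteqP; split=> [_ [[x y] /= xy <-]|[x y] /= xy] /=.
    by rewrite xy f_odd.
  exists (x^-1, - f x)%g; first by rewrite /= f_odd.
  by rewrite xy; congr pair; [apply: invgK | apply: opprK].
exists [set ((1%g, val e) : product_group F Z) | e in [set` int_range D]].
  by apply: finite_image; apply: finite_seq.
move=> _ [[x1 x2] /= ex [[y1 y2] /= ey <-]].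
have [e le defect] := f_defect x1 y1.
exists (1%g, val e); first by exists e; rewrite //= mem_int_range.
exists (x1 * y1, f (x1 * y1))%g => //.
by rewrite ex ey; congr pair; [apply: mul1g | apply: esym].
Qed.

(** The pairs at a standard distance from the graph already form a subgroup: products and inverses
    change the distance by standard amounts. *)
Lemma generated_graph (x : product_group F Z) :
  generated (graph f) x -> exists e, x.2 = val e + f x.1.
Proof.
have val0 : val 0 = 0 by apply: (addrI (val 0)); rewrite -val_add !addr0.
have valN e : val (- e) = - val e.
  by apply: (addrI (val e)); rewrite -val_add !subrr.
move=> /(_ [set y : F * Z | exists e, y.2 = val e + f y.1]); apply.
split; last by move=> [y z] yz; exists 0; rewrite val0 add0r.
have inv y : (exists e, y.2 = val e + f y.1) ->
    exists e, - y.2 = val e + f (y.1^-1)%g.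
  by move=> [e ->]; exists (- e); rewrite valN f_odd opprD.
have mul (y z : F * Z) :
    (exists e, y.2 = val e + f y.1) -> (exists e, z.2 = val e + f z.1) ->
    exists e, y.2 + z.2 = val e + f (y.1 * z.1)%g.
  move=> [e ->] [e' ->]; have [d _ hd] := f_defect y.1 z.1.
  by exists (e + e' + d); rewrite addrACA hd !val_add !addrA.
split; [|exact: mul|exact: inv].
(* The neutral element is obtained as a member times its inverse. *)
have [e] := mul (1%g, val 0 + f 1%g) (1%g^-1%g, - (val 0 + f 1%g))
  (ex_intro _ 0 erefl) (inv (1%g, _) (ex_intro _ 0 erefl)).
by rewrite /= subrr mulgV => he; exists e.
Qed.

End QuasimorphismGraph.

Theorem corollary5p11
  (F2 : groupType) (a b : F2) (alpha beta : int -> int) (f : F2 -> int)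
  (E : language) (J : interp E (carrier F2 int))
  (K : Type) (F2s : groupType) (Zs : zmodType) (fs : F2s -> Zs)
  (Js : interp E (carrier F2s Zs))
  (j : forall s : sort2, carrier F2 int s -> carrier F2s Zs s) :
  free_generators a b ->
  bounded_odd alpha -> bounded_odd beta ->
  finite_set [set n : int | alpha n = 0%R] ->
  on_words a b alpha beta f ->
  elementary_embedding (M := expansion f J) (N := expansion fs Js) j ->
  monster K (expansion fs Js) ->
  let X : set (product_group F2s Zs) := graph fs in
  let H : set (product_group F2s Zs) := generated X in
  [/\ definable0 (N := expansion fs Js) X,
      approximate_subgroup X
    & ~ exists S : set (product_group F2s Zs),
        [/\ type_definable0 (N := expansion fs Js) S, is_subgroup S,
            S `<=` H & bounded_index K H S]].
Proof.
move=> ab_free [[Ba leBa] a_odd] [[Bb leBb] b_odd] a_fin hf he hmon X H.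
pose B : nat := (absz Ba + absz Bb)%N.
have a_le n : (`|alpha n| <= B%:Z)%R by have := leBa n; rewrite /B; lia.
have b_le n : (`|beta n| <= B%:Z)%R by have := leBb n; rewrite /B; lia.
have odd0 := on_words_inv hf a_odd b_odd ab_free.
have defect0 x y : (`|f (x * y)%g - f x - f y| <= (3 * B)%:Z)%R.
  by have := on_words_defect hf a_odd b_odd a_le b_le ab_free x y; rewrite PoszM.
have odd := elementary_odd he odd0.
have defect := elementary_defect he defect0.
have jD := elementary_addZ he.
have jI := elementary_injZ he.
have j0 := elementary0 he.
split.
- exists (Eq (Var _ SZ 0) (tf (Var (sum_language base_language E) SF 0))).
    by move=> s n [[_ ->]|[i [_ ->]]].
  by apply/seteqP; split.
- exact: graph_approximate_subgroup odd defect.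
case=> S [Stype Ssub SH Sbounded].
have [K_gt _ _ hsat _] := hmon.
have [n Sn] := type_definable_bound K_gt hsat Stype
  (fun x Sx => generated_graph jD odd defect (SH x Sx)).
have small_a := elementary_centralizer he
  (on_words_centralizer_a hf a_odd b_odd a_le ab_free).
have small_b := elementary_centralizer he
  (on_words_centralizer_b hf a_odd b_le ab_free).
have mul_ab := elementary_mul_centralizers he
  (on_words_mul_centralizers hf a_odd b_odd ab_free).
(* On the centralizer of [a] the value is the image of a standard integer, so injectivity of [j]
   moves the equation to the integers, where 2 can be cancelled. *)
have opp_eq0 x : (x * j SF a = j SF a * x)%g -> fs x = (- fs x)%R -> fs x = 0%R.
  move=> xa; have [e _] := small_a x 0%N xa; rewrite expg1 => ->.
  by rewrite -(elementary_opp he) => /jI e0; have -> : e = 0%R by lia.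
have fs1 : fs 1%g = 0%R.
  by apply: opp_eq0; [rewrite mul1g mulg1 | rewrite -odd invg1].
pose L := sum_language base_language E.
pose y_ := Var L SF 1.
have [c [y [ca fc Sc]]] : exists c y,
    [/\ (c * j SF a = j SF a * c)%g, fs c <> 0%R & S (c, y)].
  (* That f y is nonzero, stated without a constant for 0. *)
  pose q : formula L := Neg (Eq (tadd (tf y_) (tf y_)) (tf y_)).
  have fvq s m : fv q s m -> s = SF /\ m = 1%N.
    by case=> // -[/tfv_add[]|] /tfv_f[].
  have add_eq (A : zmodType) (z : A) : (z + z = z)%R <-> z = 0%R.
    by split=> [zz|->]; [apply: (addrI z); rewrite addr0 | rewrite addr0].
  apply: (bounded_index_centralizer fvq he hmon _ _ _ _ Ssub Sbounded
    (Q0 := fun z => f z <> 0%R)) => [w|w|ys|].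
  - exact: not_iff_compat (add_eq _ _).
  - exact: not_iff_compat (add_eq _ _).
  - exact (on_words_separated_a hf a_odd b_odd ab_free (ys := ys) a_fin).
  - by apply.
have [d [z [db d1 Sd]]] : exists d z,
    [/\ (d * j SF b = j SF b * d)%g, d <> 1%g & S (d, z)].
  pose q : formula L := Neg (Eq (tmul y_ y_) y_).
  have fvq s m : fv q s m -> s = SF /\ m = 1%N.
    by case=> // -[/tfv_mul[]|] [].
  have mul_eq (A : groupType) (z : A) : (z * z = z)%g <-> z = 1%g.
    by split=> [zz|->]; [apply: (mulgI z); rewrite mulg1 | rewrite mulg1].
  apply: (bounded_index_centralizer fvq he hmon _ _ _ _ Ssub Sbounded
    (Q0 := fun z => z <> 1%g)) => [w|w|ys|].
  - exact: not_iff_compat (mul_eq _ _).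
  - exact: not_iff_compat (mul_eq _ _).
  - exact: free_separated (free_generatorsC ab_free).
  - by apply.
have [_ SM SV] := Ssub.
have c1 : c <> 1%g by move=> e; apply: fc; rewrite e.
have homogeneous := subgroup_homogeneous jI jD Ssub Sn.
(* The values of [fs] on powers of [c] stay within [B] of 0, so the homogeneous value at [c] is
   0. *)
have y0 : y = 0%R.
  apply: (homogeneous B c y 0%R Sc) => k.
  by have [e le ->] := small_a c k ca; exists e; rewrite // mul0rn addr0.
have z0 : z = 0%R.
  apply: (homogeneous B d z 0%R Sd) => k.
  by have [e le ->] := small_b d k db; exists e; rewrite // mul0rn addr0.
(* On powers of c t the function is exactly linear with slope fs c + fs t, so homogeneity applies
   with error 0. It is used for [d] and for its inverse. *)
have sum0 t : (t * j SF b = j SF b * t)%g -> t <> 1%g -> S (t, 0%R) ->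
    (fs c + fs t = 0)%R.
  move=> tb t1 St; apply: esym.
  have Sct : S ((c * t)%g, 0%R).
    have <- : (((c, y) : product_group F2s Zs) * (t, 0%R))%g = ((c * t)%g, 0%R).
      by rewrite y0; congr pair; apply: addr0.
    exact: SM.
  apply: (homogeneous 0%N (c * t)%g 0%R _ Sct).
  by move=> k; exists 0%R; rewrite // j0 add0r mul_ab.
have cd : (fs c + fs d = 0)%R by apply: sum0; rewrite -?z0.
have cdV : (fs c - fs d = 0)%R.
  rewrite -odd; apply: sum0.
  - exact/commute_sym/commuteV/commute_sym.
  - by move=> e; apply: d1; rewrite -[d]invgK e invg1.
  - by have := SV _ Sd; rewrite z0 => h; rewrite -[0%R]oppr0.
apply/fc/opp_eq0 => //.
by rewrite [LHS](subr0_eq cdV); apply/eqP; rewrite -addr_eq0 addrC cd.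
Qed.
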